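(* Let $K$ be a complex cubic field and let $L$ be a cubic field not isomorphic to $K$. Then $\mathrm{sh}(K)\neq\mathrm{sh}(L)$. In particular, the shape is a complete invariant in the family of complex cubic fields: two complex cubic fields with the same shape are isomorphic.
   Context: A cubic field is a number field of degree 3; it is complex if it has exactly one real embedding (and one pair of complex conjugate embeddings). For a cubic field $K$ with embeddings $\sigma_1,\sigma_2,\sigma_3:K\to\mathbf{C}$ and ring of integers $\mathcal{O}_K$, define the perp map $\alpha\mapsto\alpha^\perp:=3\alpha-\mathrm{Tr}_{K/\mathbf{Q}}(\alpha)$. If $1,\alpha_1,\alpha_2$ is a $\mathbf{Z}$-basis of $\mathcal{O}_K$, let $M(x,y)=\sum_{i=1}^3|\sigma_i(x\alpha_1^\perp+y\alpha_2^\perp)|^2$, a positive definite real binary quadratic form. For a positive definite form $Q=rx^2+sxy+ty^2$ put $z(Q)=\frac{s}{2r}+i\frac{\sqrt{4rt-s^2}}{2r}$ in the upper half-plane $\mathfrak{H}$. The shape $\mathrm{sh}(K)$ is the orbit of $z(M)$ in $\mathrm{GL}_2(\mathbf{Z})\backslash\mathfrak{H}$ (where $g=\begin{pmatrix}a&b\\c&d\end{pmatrix}$ acts by $z\mapsto\frac{az+b}{cz+d}$ if $\det g=1$ and $z\mapsto\frac{a\bar z+b}{c\bar z+d}$ if $\det g=-1$); it is independent of the chosen basis. Equivalently, $\mathrm{sh}(K)$ is the lattice $\{(\sigma_i(\gamma^\perp))_i:\gamma\in\mathcal{O}_K\}\subset\mathbf{C}^3$ with the standard Hermitian inner product, up to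 scaling, rotations and reflections. *)

(* Defs.v *)
From HB Require Import structures.
From mathcomp Require Import all_boot all_order all_algebra all_field.
From mathcomp Require Import boolp classical_sets reals.
From mathcomp Require Import complex.

Set Implicit Arguments.
Unset Strict Implicit.
Unset Printing Implicit Defensive.

Import Order.TTheory GRing.Theory Num.Theory.
Local Open Scope classical_set_scope.
Local Open Scope ring_scope.

Definition cubic_field (K : fieldExtType rat) : Prop := \dim {:K} = 3%N.

(* Ring morphisms are compared extensionally. *)
Definition complex_cubic_field (R : realType) (K : fieldExtType rat) : Prop :=
  cubic_field K /\
  exists sigma : {rmorphism K -> R},
    forall tau : {rmorphism K -> R}, tau =1 sigma.

Definition isomorphic_fields (K L : fieldExtType rat) : Prop :=
  exists f : {rmorphism K -> L}, bijective f.

Definition ring_of_integers (K : fieldExtType rat) : set K :=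
  [set a | integralOver (intr : int -> K) a].

Definition field_trace (K : fieldExtType rat) (a : K) : rat :=
  \tr (passmx.mxof (vbasis {:K}) (vbasis {:K}) (amull a)).

Definition perp (K : fieldExtType rat) (a : K) : K :=
  a *+ 3 - (field_trace a)%:A.

(* (1, a1, a2) is a Z-basis of the ring of integers of K. *)
Definition integral_basis1 (K : fieldExtType rat) (a1 a2 : K) : Prop :=
  [/\ ring_of_integers a1, ring_of_integers a2
    & forall a : K, ring_of_integers a ->
        exists! c : int * int * int,
          a = c.1.1%:~R + a1 *~ c.1.2 + a2 *~ c.2].

Definition complex_embeddings (R : realType) (K : fieldExtType rat)
    (sigma : 'I_3 -> {rmorphism K -> R[i]}) : Prop :=
  forall tau : {rmorphism K -> R[i]}, exists! i : 'I_3, tau =1 sigma i.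

Definition shape_form (R : realType) (K : fieldExtType rat)
    (sigma : 'I_3 -> {rmorphism K -> R[i]}) (a1 a2 : K) (x y : int) : R :=
  \sum_(i < 3) Normc.normc (sigma i (perp a1 *~ x + perp a2 *~ y)) ^+ 2.

(* The coefficients of Q = r x^2 + s x y + t y^2 are recovered from the
   values of Q at (1, 0), (0, 1) and (1, 1). *)
Definition form_point (R : realType) (Q : int -> int -> R) : R[i] :=
  let r := Q 1 0 in
  let t := Q 0 1 in
  let s := Q 1 1 - r - t in
  Complex (s / (2 * r)) (Num.sqrt (4 * r * t - s ^+ 2) / (2 * r)).

(* For g in GL_2(Z), i.e. \det g = 1 or \det g = -1. *)
Definition GL2Z_act (R : realType) (g : 'M[int]_2) (z : R[i]) : R[i] :=
  let z' := if \det g == 1 then z else conjc z in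
  ((g 0 0)%:~R * z' + (g 0 1)%:~R) / ((g 1 0)%:~R * z' + (g 1 1)%:~R).

Definition GL2Z_orbit (R : realType) (z : R[i]) : set R[i] :=
  [set w | exists2 g : 'M[int]_2, g \in unitmx & w = GL2Z_act g z].

(* A point of GL_2(Z)\H is represented by the corresponding orbit, a set of
   complex numbers. The orbit of the point of shape_form does not depend on
   the integral basis or on the enumeration of the embeddings, so the union
   over all these choices is that single orbit. *)
Definition cubic_shape (R : realType) (K : fieldExtType rat) : set R[i] :=
  [set w | exists sigma : 'I_3 -> {rmorphism K -> R[i]},
           exists a1 a2 : K,
    [/\ complex_embeddings sigma, integral_basis1 a1 a2
      & GL2Z_orbit (form_point (shape_form sigma a1 a2)) w]].
Arguments cubic_shape R K : clear implicits.

(* Main.v *)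
Require Import Defs.
From HB Require Import structures.
From mathcomp Require Import all_boot all_order all_algebra all_field.
From mathcomp Require Import boolp classical_sets reals.
From mathcomp Require Import complex.
From mathcomp Require Import ring lra.

(** For [a] of trace zero put [q a := perp (a ^ 2) = 3 a ^ 2 - Tr (a ^ 2)].
    If [K] is complex with real embedding [rho], then [M a = rho (q a)], because
    the two other conjugates of [a] are complex conjugate with real part
    [- rho a / 2]. If [K] is totally real, [M a] is the rational number
    [Tr (a ^ 2)]. In both cases [M] has coefficients in the image of a real
    embedding, hence so do [z + z^*] and [z * z^*] for the point [z] of [M], and
    this property of [z] is invariant under [GL_2(Z)]. So if [L] has the same
    shape as the complex field [K] and [u], [v] are the perps of an integral
    basis of [K], the ratios [perp (u v) / perp (u ^ 2)] and
    [perp (v ^ 2) / perp (u ^ 2)] are mapped by [rho] into a real image of [L].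
    They are not both rational, as otherwise [v / u] would be a root of a
    rational quadratic polynomial. Since an irrational element generates [K],
    the field [rho K] is contained in that image of [L], which has the same
    degree. The shapes involved are not empty because integral bases exist. *)

Set Implicit Arguments.
Unset Strict Implicit.
Unset Printing Implicit Defensive.

Import Order.TTheory GRing.Theory Num.Theory.
Local Open Scope ring_scope.
Local Open Scope complex_scope.

(** * Morphisms of number fields *)

Lemma rmorphism_of_graph (A B : nzRingType) (G : A -> B -> Prop) :
    (forall x, exists y, G x y) -> (forall y, G 0 y -> y = 0) -> G 1 1 ->
    (forall x x' y y', G x y -> G x' y' -> G (x - x') (y - y')) ->
    (forall x x' y y', G x y -> G x' y' -> G (x * x') (y * y')) ->
  exists f : {rmorphism A -> B}, forall x, G x (f x).
Proof.
move=> Gtotal G0 G1 GB GM; have [f Gf] := choice Gtotal.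
have fE x y : G x y -> f x = y.
  by move=> /(GB _ _ _ _ (Gf x)); rewrite subrr => /G0/subr0_eq.
have fB : zmod_morphism f by move=> x x'; apply/fE/GB.
have fM : monoid_morphism f by split=> [|x x']; apply/fE => //; apply: GM.
pose fBM := GRing.isZmodMorphism.Build A B f fB.
pose fMM := GRing.isMonoidMorphism.Build A B f fM.
pose fRM : {rmorphism A -> B} := HB.pack f fBM fMM.
by exists fRM.
Qed.

Lemma rmorphism_factor (A B C : nzRingType) (f : {rmorphism A -> C})
    (g : {rmorphism B -> C}) :
    injective g -> (forall x, exists y, g y = f x) ->
  exists h : {rmorphism A -> B}, forall x, g (h x) = f x.
Proof.
move=> g_inj fg.
apply: (@rmorphism_of_graph A B (fun x y => g y = f x)) => //.
- by move=> y; rewrite rmorph0 -(rmorph0 g) => /g_inj.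
- by rewrite !rmorph1.
- by move=> x x' y y' xy xy'; rewrite !rmorphB xy xy'.
by move=> x x' y y' xy xy'; rewrite !rmorphM xy xy'.
Qed.

Definition rmorph_image (E F : fieldType) (f : {rmorphism E -> F}) : {pred F} :=
  fun y => `[< exists x, f x = y >].

Lemma mem_rmorph_image (E F : fieldType) (f : {rmorphism E -> F}) x :
  f x \in rmorph_image f.
Proof. by apply/asboolP; exists x. Qed.

Lemma rmorph_imageP (E F : fieldType) (f : {rmorphism E -> F}) y :
  reflect (exists x, f x = y) (y \in rmorph_image f).
Proof. exact: asboolP. Qed.

Lemma rmorph_image_divring_closed (E F : fieldType) (f : {rmorphism E -> F}) :
  divring_closed (rmorph_image f).
Proof.
split=> [|_ _ /rmorph_imageP[x <-] /rmorph_imageP[y <-]|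
          _ _ /rmorph_imageP[x <-] /rmorph_imageP[y <-]].
- by rewrite -(rmorph1 f) mem_rmorph_image.
- by rewrite -rmorphB mem_rmorph_image.
by rewrite -fmorph_div mem_rmorph_image.
Qed.

HB.instance Definition _ (E F : fieldType) (f : {rmorphism E -> F}) :=
  GRing.isDivringClosed.Build F (rmorph_image f)
    (rmorph_image_divring_closed f).

Definition primitive_element (K : fieldExtType rat) (x : K) : Prop :=
  <<1; x>>%VS = fullv.

Section NumberFields.

Variable K : fieldExtType rat.
Implicit Types (x y : K) (p q : {poly rat}).

Lemma rmorph_horner_alg (F : unitRingType) (f : {rmorphism K -> F}) x p :
  f (horner_alg x p) = (map_poly ratr p).[f x].
Proof.
rewrite -horner_map -map_poly_comp; congr (_.[_]); apply: eq_map_poly => a /=.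
by rewrite rmorphZ_num rmorph1 mulr1.
Qed.

Lemma separable_minPoly x : separable_poly (minPoly 1 x).
Proof. by apply: pcharf0_separable => p; rewrite pchar_lalg pchar_num. Qed.

Lemma primitive_element_exists : exists x, primitive_element x.
Proof.
exists (separable_generator 1 {:K}).
rewrite /primitive_element.
rewrite -(@eq_adjoin_separable_generator _ _ {:K}%AS) ?subvf //.
by apply/separableP => x _; apply: separable_minPoly.
Qed.

Lemma primitive_elementP x :
  primitive_element x -> forall y, exists p, y = horner_alg x p.
Proof. by move=> x_prim y; apply/Fadjoin1_polyP; rewrite x_prim memvf. Qed.

Lemma eq_rmorph_primitive (F : unitRingType) (f g : {rmorphism K -> F}) x :
  primitive_element x -> f x = g x -> f =1 g.
Proof.
move=> /primitive_elementP x_prim fgx y; have [p ->] := x_prim y.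
by rewrite !rmorph_horner_alg fgx.
Qed.

Lemma adjoin_degree_primitive x :
  primitive_element x -> adjoin_degree 1 x = \dim {:K}.
Proof. by move=> x_prim; rewrite -x_prim dim_Fadjoin dimv1 muln1. Qed.

Lemma rat_minPolyP x :
  exists p, [/\ minPoly 1 x = map_poly (in_alg K) p, p \is monic &
    forall q, (horner_alg x q == 0) = (p %| q)].
Proof.
have /polyOver1P[p minE] := minPolyOver 1%AS x; exists p; split=> // [|q].
  by rewrite -(map_monic (in_alg K)) -minE monic_minPoly.
rewrite -(dvdp_map (in_alg K)) -minE; apply/idP/idP => [qx0|/dvdpP[r qE]].
  by apply: minPoly_dvdp; [apply: alg_polyOver | apply: qx0].
by rewrite /horner_alg /horner_morph qE hornerM minPolyxx mulr0.
Qed.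

Lemma primitive_element_free x q :
  primitive_element x -> (size q <= \dim {:K})%N -> horner_alg x q = 0 -> q = 0.
Proof.
move=> x_prim q_size /eqP qx; have [p [minE _ pP]] := rat_minPolyP x.
apply/eqP; apply: contraTT q_size => q_neq0; rewrite -ltnNge.
rewrite -(adjoin_degree_primitive x_prim) -size_minPoly minE size_map_poly.
by apply: dvdp_leq; rewrite // -pP.
Qed.

Lemma rmorphism_of_root (F : numFieldType) x (z : F) :
    primitive_element x ->
    (forall q, horner_alg x q = 0 -> root (map_poly ratr q) z) ->
  exists f : {rmorphism K -> F}, f x = z.
Proof.
move=> /primitive_elementP x_prim zP.
pose G y w := exists2 q, y = horner_alg x q & w = (map_poly ratr q).[z].
have [f fG] : exists f : {rmorphism K -> F}, forall y, G y (f y).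
  apply: rmorphism_of_graph.
  - by move=> y; have [q ->] := x_prim y; eexists; exists q.
  - by move=> w [q /esym/zP/rootP qz ->].
  - by exists 1; rewrite !rmorph1 ?hornerC.
  - move=> _ _ _ _ [q -> ->] [r -> ->]; exists (q - r).
      by rewrite rmorphB.
    by rewrite rmorphB hornerD hornerN.
  - move=> _ _ _ _ [q -> ->] [r -> ->]; exists (q * r).
      by rewrite rmorphM.
    by rewrite rmorphM hornerM.
have [q qx fx] := fG x; exists f; apply: subr0_eq.
suff /zP/rootP : horner_alg x (q - 'X) = 0.
  by rewrite rmorphB /= map_polyX hornerD hornerN hornerX fx.
by rewrite rmorphB /= -qx horner_algX subrr.
Qed.

End NumberFields.

Lemma rmorph_bijective (K L : fieldExtType rat) (h : {rmorphism K -> L}) :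
  \dim {:K} = \dim {:L} -> bijective h.
Proof.
move=> dimKL; pose hZ := GRing.isScalable.Build rat K L *:%R h (fmorph_numZ h).
pose hL : {linear K -> L} := HB.pack (GRing.RMorphism.sort h) hZ.
have h_ker : lker (linfun hL) == 0%VS.
  by apply/lker0P => x y; rewrite !lfunE /=; apply: fmorph_inj.
have h_img : limg (linfun hL) = fullv.
  apply/eqP; rewrite eqEdim subvf limg_dim_eq ?(eqP h_ker) ?capv0 //=.
  by rewrite dimKL.
exists (linfun hL)^-1%VF => [x|y].
  by have := lker0_lfunK h_ker x; rewrite lfunE.
by have := @limg_lfunVK _ _ _ (linfun hL) y; rewrite lfunE h_img memvf; apply.
Qed.

Lemma isomorphic_of_primitive_in_image (K L : fieldExtType rat) (F : fieldType)
    (f : {rmorphism K -> F}) (g : {rmorphism L -> F}) (x : K) :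
    \dim {:K} = \dim {:L} -> primitive_element x -> f x \in rmorph_image g ->
  isomorphic_fields K L.
Proof.
move=> dimKL x_prim /rmorph_imageP[y gy].
have [|z|h _] := rmorphism_factor (f := f) (g := g); first exact: fmorph_inj.
  have [p ->] := primitive_elementP x_prim z; exists (horner_alg y p).
  by rewrite !rmorph_horner_alg gy.
by exists h; apply: rmorph_bijective.
Qed.

(** * Embeddings and the trace *)

Definition embedding_enumeration (K : fieldExtType rat) (F : fieldType)
    (n : nat) (sigma : 'I_n -> {rmorphism K -> F}) : Prop :=
  forall tau : {rmorphism K -> F}, exists! i, tau =1 sigma i.

Lemma embedding_enumeration_exists (K : fieldExtType rat) (n : nat)
    (C : numClosedFieldType) : \dim {:K} = n ->
  exists sigma : 'I_n -> {rmorphism K -> C}, embedding_enumeration sigma.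
Proof.
move=> dimK; have [x x_prim] := primitive_element_exists K.
have [p [minE p_monic pP]] := rat_minPolyP x.
have [rs] := closed_field_poly_normal (map_poly (ratr : rat -> C) p).
rewrite (monicP _) ?map_monic // scale1r => pE.
have rs_size : size rs = n.
  apply/succn_inj; rewrite -(size_prod_XsubC rs id) -pE size_map_poly.
  rewrite -(size_map_poly (in_alg K)) -minE size_minPoly.
  by rewrite adjoin_degree_primitive ?dimK.
have rs_uniq : uniq rs.
  rewrite -separable_prod_XsubC -pE separable_map.
  rewrite -(separable_map (in_alg K)) -minE.
  exact: separable_minPoly.
have root_rs z : z \in rs -> root (map_poly ratr p) z.
  by rewrite pE root_prod_XsubC.
have /fin_all_exists[sigma sigmaE] (i : 'I_n) :
    exists f : {rmorphism K -> C}, f x = rs`_i.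
  apply: (rmorphism_of_root x_prim) => q /eqP; rewrite pP => /dvdpP[r ->].
  by rewrite rmorphM rootM root_rs ?orbT // mem_nth ?rs_size.
exists sigma => tau; have tau_rs : tau x \in rs.
  rewrite -root_prod_XsubC -pE rootE -rmorph_horner_alg fmorph_eq0.
  by rewrite pP dvdpp.
have index_lt : (index (tau x) rs < n)%N by rewrite -rs_size index_mem.
exists (Ordinal index_lt); split=> [|i tauE].
  by apply: (eq_rmorph_primitive x_prim); rewrite sigmaE nth_index.
by apply: val_inj; rewrite /= tauE sigmaE index_uniq ?rs_size.
Qed.

Lemma field_trace_is_scalar (K : fieldExtType rat) : scalar (@field_trace K).
Proof.
move=> a x y.
by rewrite /field_trace [amull _]linearP passmx.mxof_linear [LHS]linearP.
Qed.

HB.instance Definition _ (K : fieldExtType rat) :=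
  GRing.isLinear.Build rat K rat *%R (@field_trace K)
    (@field_trace_is_scalar K).

Section Embeddings.

Variables (K : fieldExtType rat) (F : numFieldType) (n : nat).
Variable sigma : 'I_n -> {rmorphism K -> F}.
Hypotheses (dimK : \dim {:K} = n) (sigma_enum : embedding_enumeration sigma).

Lemma embedding_enumeration_inj i j : sigma i =1 sigma j -> i = j.
Proof.
move=> sij; have [k [_ kP]] := sigma_enum (sigma j).
by rewrite -(kP i) ?(kP j).
Qed.

Lemma embeddings_linearly_independent (c : 'I_n -> F) :
  (forall x, \sum_i c i * sigma i x = 0) -> forall i, c i = 0.
Proof.
move=> c_rel; have [x x_prim] := primitive_element_exists K.
pose V := Vandermonde n (\row_i sigma i x).
have V_unit : V \in unitmx.
  rewrite unitmxE unitfE det_Vandermonde.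
  apply/prodf_neq0 => i _; apply/prodf_neq0 => j ltij; rewrite !mxE subr_eq0.
  apply: contraL ltij => /eqP/(eq_rmorph_primitive x_prim) sij.
  by rewrite (embedding_enumeration_inj sij) ltnn.
have V_ker : V *m (\col_i c i) = 0.
  apply/colP => k; rewrite !mxE -[RHS](c_rel (x ^+ k)); apply: eq_bigr => i _.
  by rewrite !mxE rmorphXn mulrC.
move=> i; have /colP/(_ i) := mulKmx V_unit (\col_i c i).
by rewrite V_ker mulmx0 !mxE.
Qed.

Lemma rmorph_coord_vbasis (f : {rmorphism K -> F}) x :
  f x = \sum_i ratr (coord (vbasis {:K}) i x) * f (vbasis {:K})`_i.
Proof.
rewrite {1}(coord_vbasis (memvf x)) rmorph_sum; apply: eq_bigr => i _ /=.
exact: rmorphZ_num.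
Qed.

(* The matrix [E] of evaluations at a basis diagonalizes multiplication by [x],
   with the conjugates of [x] as eigenvalues. *)
Lemma field_trace_sum x : ratr (field_trace x) = \sum_i sigma i x.
Proof.
pose e := vbasis {:K}.
pose E : 'M[F]_(_, n) := \matrix_(i, j) sigma j e`_(i : 'I_(\dim {:K})).
pose A := map_mx (ratr : rat -> F) (passmx.mxof e e (amull x)).
pose D : 'M[F]_n := diag_mx (\row_j sigma j x).
have AE_ED : A *m E = E *m D.
  apply/matrixP => i j; rewrite mul_mx_diag !mxE mulrC -rmorphM.
  rewrite rmorph_coord_vbasis.
  by apply: eq_bigr => k _; rewrite !mxE /= passmx.vecof_delta lfunE.
have E_full : row_full E.
  rewrite /row_full -mxrank_tr; apply: inj_row_free => c cE; apply/rowP => j.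
  rewrite mxE; apply: (@embeddings_linearly_independent (c 0)) => y.
  under eq_bigr => i _ do rewrite rmorph_coord_vbasis mulr_sumr.
  rewrite exchange_big big1 //= => k _.
  transitivity (ratr (coord e k y) * (c *m E^T) 0 k); last first.
    by rewrite cE mxE mulr0.
  by rewrite mxE mulr_sumr; apply: eq_bigr => i _; rewrite !mxE mulrCA.
have E_free : row_free E by rewrite /row_free (eqP E_full) dimK.
rewrite -[ratr _](trace_map_mx (ratr : {rmorphism rat -> F})) -/e -/A.
rewrite -[A]mulmx1 -(mulmxVp E_free) mulmxA AE_ED mxtrace_mulC mulmxA.
rewrite mulVpmx // mul1mx mxtrace_diag.
by apply: eq_bigr => i _; rewrite mxE.
Qed.

End Embeddings.

Section TraceForm.

Variable K : fieldExtType rat.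

Lemma field_trace1 : field_trace (1 : K) = (\dim {:K})%:R.
Proof.
rewrite /field_trace amull1 passmx.mxof1 ?mxtrace1 //.
exact: basis_free (vbasisP _).
Qed.

Lemma field_trace_nondegenerate (x : K) :
  (forall y, field_trace (x * y) = 0) -> x = 0.
Proof.
move=> tr0; apply/eqP/negPn/negP => x_neq0; have /eqP := tr0 x^-1.
by rewrite divff // field_trace1 pnatr_eq0 eqn0Ngt adim_gt0.
Qed.

Lemma scalar_coord_vbasis (phi : {scalar K}) x :
  phi x = \sum_i coord (vbasis {:K}) i x * phi (vbasis {:K})`_i.
Proof.
rewrite {1}(coord_vbasis (memvf x)) linear_sum; apply: eq_bigr => i _.
by rewrite linearZ.
Qed.

Lemma scalar_trace_representation (phi : {scalar K}) :
  exists b, forall x, phi x = field_trace (x * b).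
Proof.
pose d := \dim {:K}; pose e := vbasis {:K}.
pose T : 'M_d := \matrix_(i, j) field_trace (e`_j * e`_i).
pose vec (c : 'rV_d) := \sum_i c 0 i *: e`_i.
have mulT c j : (c *m T) 0 j = field_trace (e`_j * vec c).
  rewrite mxE mulr_sumr linear_sum; apply: eq_bigr => i _.
  by rewrite !mxE -scalerAr linearZ.
have trE c x : field_trace (x * vec c) = \sum_j coord e j x * (c *m T) 0 j.
  under eq_bigr => j _ do rewrite mulT.
  rewrite {1}(coord_vbasis (memvf x)) mulr_suml linear_sum.
  by apply: eq_bigr => j _; rewrite -scalerAl linearZ.
have T_unit : T \in unitmx.
  rewrite -row_free_unit; apply: inj_row_free => c cT0; apply/rowP => i.
  rewrite mxE -(coord_sum_free (c 0) i (basis_free (vbasisP {:K}))) -/(vec c).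
  suff -> : vec c = 0 by rewrite linear0.
  apply: field_trace_nondegenerate => x; rewrite mulrC trE big1 // => j _.
  by rewrite cT0 mxE mulr0.
exists (vec ((\row_i phi e`_i) *m invmx T)) => x.
rewrite trE mulmxKV // scalar_coord_vbasis.
by apply: eq_bigr => j _; rewrite mxE.
Qed.

End TraceForm.

(** * Integral bases *)

Lemma fmorph_integral (F E : fieldType) (f : {rmorphism F -> E}) (x : F) :
  integralOver (intr : int -> E) (f x) <-> integralOver (intr : int -> F) x.
Proof.
have intr_f p : map_poly intr p = map_poly f (map_poly intr p).
  by rewrite -map_poly_comp; apply: eq_map_poly => n /=; rewrite rmorph_int.
by split=> -[p p_monic px]; exists p; move: px; rewrite // intr_f fmorph_root.
Qed.

Lemma integral_rat (a : rat) :
  integralOver (intr : int -> rat) a -> a \is a Num.int.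
Proof.
move/(fmorph_integral (ratr : {rmorphism rat -> algC})) => -[p p_monic pa].
rewrite -Cint_rat; apply: Cint_rat_Aint; first exact: Crat_rat.
apply: root_monic_Aint pa _ _; first exact: monic_map.
by apply/polyOverP => i; rewrite coef_map intr_int.
Qed.

Definition integers (K : fieldExtType rat) : {pred K} :=
  fun x => `[< ring_of_integers x >].
Arguments integers : clear implicits.

Lemma integersP (K : fieldExtType rat) (x : K) :
  reflect (ring_of_integers x) (x \in integers K).
Proof. exact: asboolP. Qed.

Lemma integers_subring_closed (K : fieldExtType rat) :
  subring_closed (integers K).
Proof.
split=> [|x y /integersP Ox /integersP Oy|x y /integersP Ox /integersP Oy];
  apply/integersP.
- exact: (@integral1 _ _ (intr : {rmorphism int -> K})).
- exact: (@integral_sub _ _ (intr : {rmorphism int -> K})).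
exact: (@integral_mul _ _ (intr : {rmorphism int -> K})).
Qed.

HB.instance Definition _ (K : fieldExtType rat) :=
  GRing.isSubringClosed.Build K (integers K) (@integers_subring_closed K).

(* This is [c ^ n * p (X / c)], where [n] is the degree of [p]. *)
Definition dilate_poly (R : nzRingType) (c : R) (p : {poly R}) : {poly R} :=
  \poly_(i < size p) (p`_i * c ^+ ((size p).-1 - i)).

Lemma monic_dilate (R : nzRingType) (c : R) (p : {poly R}) :
  p \is monic -> dilate_poly c p \is monic.
Proof.
move=> p_monic; have p_size := polySpred (monic_neq0 p_monic).
have lead1 : p`_(size p).-1 * c ^+ ((size p).-1 - (size p).-1) = 1.
  by rewrite subnn mulr1 -lead_coefE (monicP p_monic).
rewrite monicE lead_coefE /dilate_poly p_size.
rewrite size_poly_eq //= ?lead1 ?oner_eq0 //.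
by rewrite coef_poly ltnSn lead1.
Qed.

Lemma horner_alg_dilate (R : comNzRingType) (A : algType R) (c : R)
    (p : {poly R}) (x : A) :
  horner_alg (c *: x) (dilate_poly c p) = c ^+ (size p).-1 *: horner_alg x p.
Proof.
rewrite -[X in _ *: horner_alg x X]coefK /dilate_poly !poly_def !linear_sum.
apply: eq_bigr => i _; rewrite /= !linearZ /= !mulr_algl !rmorphXn /=.
rewrite !horner_algX exprZn !scalerA.
have /subnK {2}<- : (i <= (size p).-1)%N.
  by rewrite -ltnS (ltn_predK (ltn_ord i)).
by congr (_ *: _); rewrite exprD -mulrA mulrC.
Qed.

Lemma dilate_monic_integral (p : {poly rat}) : p \is monic ->
  exists2 N : int, N != 0 &
    exists2 r : {poly int}, r \is monic & map_poly intr r = dilate_poly N%:~R p.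
Proof.
move=> p_monic; have [q [N N_neq0 pE]] := rat_poly_scale p; exists N => //.
have p_size := polySpred (monic_neq0 p_monic).
have /floorpP[r rE] : dilate_poly N%:~R p \is a polyOver Num.int.
  apply/polyOver_poly => i; rewrite p_size ltnS leq_eqVlt => /predU1P[->|lt_i].
    by rewrite subnn mulr1 -lead_coefE (monicP p_monic) rpred1.
  have -> : p`_i = N%:~R^-1 * (q`_i)%:~R by rewrite {1}pE coefZ coef_map.
  rewrite -(subnSK lt_i) exprS mulrACA mulVf ?intr_eq0 // mul1r.
  by rewrite rpredM ?rpredX ?rpred_int.
exists r; last by rewrite rE.
have := monic_dilate N%:~R p_monic; rewrite rE !monicE lead_coef_map_inj //.
  by rewrite -(rmorph1 (intr : {rmorphism int -> rat})) (inj_eq intr_inj).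
exact: intr_inj.
Qed.

Section Integers.

Variable K : fieldExtType rat.

Lemma rational_integer (x : K) :
  x \in 1%VS -> x \in integers K -> exists n : int, x = n%:~R.
Proof.
move=> /vlineP[a ->] /integersP/(fmorph_integral (in_alg K))/integral_rat.
by move=> /intrP[n ->]; exists n; rewrite scaler_int.
Qed.

Lemma integer_multiple (x : K) :
  exists2 N : int, N != 0 & x *~ N \in integers K.
Proof.
have [p [minE p_monic _]] := rat_minPolyP x.
have [N N_neq0 [r r_monic rE]] := dilate_monic_integral p_monic.
exists N => //; apply/integersP; exists r => //.
have -> : map_poly (intr : int -> K) r = map_poly (in_alg K) (map_poly intr r).
  by rewrite -map_poly_comp; apply: eq_map_poly => m /=; rewrite scaler_int.
rewrite rootE -[X in X == _]/(horner_alg (x *~ N) (map_poly intr r)) rE.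
rewrite -scaler_int horner_alg_dilate [horner_alg x p](_ : _ = 0) ?scaler0 //.
by rewrite /horner_alg /horner_morph -minE minPolyxx.
Qed.

Lemma field_trace_integer (x : K) :
  x \in integers K -> field_trace x \is a Num.int.
Proof.
move=> /integersP Ox.
have [sigma sigma_enum] :=
  embedding_enumeration_exists algC (erefl (\dim {:K})).
apply/integral_rat/(fmorph_integral (ratr : {rmorphism rat -> algC})).
rewrite /= (field_trace_sum (erefl _) sigma_enum).
apply: (big_ind (integralOver (intr : int -> algC))) => [|y z|i _].
- exact: (@integral0 _ _ (intr : {rmorphism int -> algC})).
- exact: (@integral_add _ _ (intr : {rmorphism int -> algC})).
exact/fmorph_integral.
Qed.

Lemma scalar_integer_multiple (phi : {scalar K}) :
  exists2 N : int, N != 0 &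
    {in integers K, forall x, N%:~R * phi x \is a Num.int}.
Proof.
have [b phiE] := scalar_trace_representation phi.
have [N N_neq0 Ob] := integer_multiple b.
exists N => // x Ox; rewrite phiE -linearZ /= scaler_int -mulrzAr.
by rewrite field_trace_integer ?rpredM.
Qed.

End Integers.

Definition additive_ker (V W : zmodType) (O : {pred V}) (f : V -> W) :
    {pred V} :=
  [pred x | (x \in O) && (f x == 0)].

Lemma additive_ker_zmod_closed (V W : zmodType) (O : zmodClosed V)
  (f : {additive V -> W}) : zmod_closed (additive_ker O f).
Proof.
split=> [|x y]; rewrite !inE ?rpred0 ?raddf0 ?eqxx //.
move=> /andP[Ox /eqP fx] /andP[Oy /eqP fy].
by rewrite rpredB // raddfB fx fy subrr eqxx.
Qed.

HB.instance Definition _ (V W : zmodType) (O : zmodClosed V)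
    (f : {additive V -> W}) :=
  GRing.isZmodClosed.Build V (additive_ker O f) (additive_ker_zmod_closed O f).

Section OrdCons.

Variables (T : Type) (n : nat).

Definition ord_cons (a0 : T) (a : 'I_n -> T) (i : 'I_n.+1) : T :=
  oapp a a0 (unlift ord0 i).

Lemma ord_cons0 a0 a : ord_cons a0 a ord0 = a0.
Proof. by rewrite /ord_cons unlift_none. Qed.

Lemma ord_cons_lift a0 a i : ord_cons a0 a (lift ord0 i) = a i.
Proof. by rewrite /ord_cons liftK. Qed.

End OrdCons.

Lemma sum_ord_cons (V : zmodType) n (w0 : V) (w : 'I_n -> V)
    (c : 'I_n.+1 -> int) :
  \sum_i ord_cons w0 w i *~ c i =
  w0 *~ c ord0 + \sum_i w i *~ c (lift ord0 i).
Proof.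
rewrite big_ord_recl ord_cons0; congr (_ + _).
by apply: eq_bigr => i _; rewrite ord_cons_lift.
Qed.

Definition integral_dual_system (V : zmodType) (R : archiRealDomainType)
    (n : nat) (O : {pred V}) (f : 'I_n -> V -> R) : Prop :=
  (forall i, {in O, forall x, f i x \is a Num.int}) /\
  (forall i, exists x,
     [/\ x \in O, f i x != 0 & forall j, j != i -> f j x = 0]).

Section IntegralFunctionals.

Variables (V : zmodType) (R : archiRealDomainType).
Implicit Types (O : zmodClosed V) (f : {additive V -> R}).

(* [w] realizes the least positive value of [f] on [O]. *)
Lemma additive_generator O f :
    {in O, forall x, f x \is a Num.int} -> (exists2 x, x \in O & f x != 0) ->
  exists w, [/\ w \in O, f w != 0 &
    {in O, forall x, exists c : int, f (x - w *~ c) = 0}].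
Proof.
move=> f_int [x0 Ox0 fx0].
pose P n := `[< exists2 x, x \in O & f x = n.+1%:R >].
have exP : exists n, P n.
  have /intrP[m fx0E] := f_int _ Ox0; exists `|m|.-1; apply/asboolP.
  exists (x0 *~ sgz m); first exact: rpredMz.
  rewrite raddfMz fx0E prednK; last first.
    by rewrite absz_gt0; apply: contraNneq fx0 => m0; rewrite fx0E m0.
  by rewrite -mulrzA mulrC -abszEsg.
have [n /asboolP[w Ow fw] n_min] := ex_minnP exP.
exists w; split=> // [|x Ox]; first by rewrite fw pnatr_eq0.
have /intrP[m fx] := f_int _ Ox; exists (m %/ n.+1)%Z.
have Oy : x - w *~ (m %/ n.+1)%Z \in O by rewrite rpredB ?rpredMz.
have fy : f (x - w *~ (m %/ n.+1)%Z) = (m %% n.+1)%Z%:~R.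
  by rewrite raddfB raddfMz fx fw {1}(divz_eq m n.+1) intrD intrM -mulrzr; ring.
move: fy (modz_ge0 m (isT : n.+1 != 0 :> int)).
move: (ltz_pmod m (isT : 0 < n.+1 :> int)).
case: (m %% n.+1)%Z => // -[|k] // lt_kn fy _.
have /n_min : P k by apply/asboolP; exists (x - w *~ (m %/ n.+1)%Z).
by rewrite leqNgt -ltnS -ltz_nat lt_kn.
Qed.

(* Hermite reduction: an element generating the values of the first functional
   is completed by a basis of the kernel of that functional. *)
Lemma integral_dual_system_basis n O (f : 'I_n -> {additive V -> R}) :
    integral_dual_system O f ->
  exists w : 'I_n -> V, [/\ forall i, w i \in O,
    {in O, forall x, exists c : 'I_n -> int,
       forall i, f i (x - \sum_j w j *~ c j) = 0} &
    forall c : 'I_n -> int,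
      (forall i, f i (\sum_j w j *~ c j) = 0) -> forall j, c j = 0].
Proof.
elim: n O f => [|n IHn] O f [f_int f_dual].
  by exists (fun=> 0); split=> [[]|x _|c _ []] //; exists (fun=> 0) => -[].
pose O0 := additive_ker O (f ord0).
have [|w0 [Ow0 fw0 w0_gen]] := additive_generator (f_int ord0).
  by have [x [Ox fx _]] := f_dual ord0; exists x.
have [|w [Ow w_gen w_free]] := IHn O0 (fun i => f (lift ord0 i)).
  split=> [i x /andP[Ox _]|i]; first exact: f_int.
  have [x [Ox fx fx0]] := f_dual (lift ord0 i); exists x; split=> // [|j ji].
    by rewrite inE Ox fx0 ?eqxx // neq_lift.
  by rewrite fx0 // (inj_eq lift_inj).
have fw c : f ord0 (\sum_j w j *~ c j) = 0.
  suff /andP[_ /eqP] : \sum_j w j *~ c j \in O0 by [].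
  by apply: rpred_sum => j _; apply: rpredMz.
exists (ord_cons w0 w); split=> [i|x Ox|c fc].
- case: (unliftP ord0 i) => [j|] ->; rewrite ?ord_cons0 ?ord_cons_lift //.
  by have /andP[] := Ow j.
- have [c0 fx] := w0_gen x Ox; have Ox' : x - w0 *~ c0 \in O0.
    by rewrite inE rpredB ?rpredMz // fx eqxx.
  have [c cP] := w_gen _ Ox'; exists (ord_cons c0 c) => i.
  rewrite sum_ord_cons ord_cons0 opprD addrA.
  under eq_bigr do rewrite ord_cons_lift.
  by case: (unliftP ord0 i) => [j|] ->; rewrite ?cP // raddfB fx fw subr0.
have c0 : c ord0 = 0.
  have /eqP := fc ord0; rewrite sum_ord_cons raddfD fw addr0 raddfMz mulrz_eq0.
  by rewrite (negPf fw0) orbF => /eqP.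
move=> j; case: (unliftP ord0 j) => [i|] -> //.
apply: (w_free (fun i => c (lift ord0 i))) => k.
by have := fc (lift ord0 k); rewrite sum_ord_cons c0 mulr0z add0r.
Qed.

End IntegralFunctionals.

Section IntegralBasis.

Variables (K : fieldExtType rat) (n : nat).
Hypothesis dimK : \dim {:K} = n.+1.

Lemma basis_extending1 : exists X : n.-tuple K, basis_of {:K} (1 :: X).
Proof.
pose X := vbasis (1^C : {vspace K}).
have X_size : size X == n by rewrite size_tuple dimv_compl dimK dimv1 subn1.
exists (Tuple X_size); rewrite -cat1s -(addv_complf 1%VS).
apply: cat_basis (vbasisP _); first by apply/directv_addP/capv_compl.
by rewrite seq1_basis ?oner_eq0.
Qed.

(* The witnesses are multiples of coordinates along a basis extending [1]. *)
Lemma integers_dual_system_exists :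
  exists2 f : 'I_n -> {additive K -> rat}, integral_dual_system (integers K) f &
    forall x, (forall i, f i x = 0) <-> x \in 1%VS.
Proof.
have [X X_basis] := basis_extending1.
pose e := [tuple of 1 :: X]; have e_free : free e := basis_free X_basis.
pose phi (i : 'I_n) : {scalar K} := coord e (lift ord0 i).
have phiX (i j : 'I_n) : phi i X`_j = (j == i)%:R.
  have := coord_free (lift ord0 j) (lift ord0 i) e_free.
  by rewrite (inj_eq lift_inj).
have phi1 i : phi i 1 = 0 := coord_free ord0 (lift ord0 i) e_free.
have /fin_all_exists[N /all_and2[N_neq0 phi_int]] i : exists N : int, N != 0 /\
    {in integers K, forall x, N%:~R * phi i x \is a Num.int}.
  by have [N] := scalar_integer_multiple (phi i); exists N.
have NQ_neq0 i : (N i)%:~R != 0 :> rat by rewrite intr_eq0.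
exists (fun i => (N i)%:~R \*o phi i) => [|x].
  split=> // i; have [M M_neq0 OM] := integer_multiple X`_i.
  exists (X`_i *~ M).
  have fX j : (N j)%:~R * phi j (X`_i *~ M) = (N j)%:~R * (M%:~R * (i == j)%:R).
    by rewrite -scaler_int linearZ /= phiX.
  split=> // [|j /negPf ji] /=; rewrite fX; last by rewrite eq_sym ji !mulr0.
  by rewrite eqxx mulr1 mulf_neq0 ?intr_eq0.
split=> [fx|/vlineP[a ->] i /=].
  rewrite (coord_basis X_basis (memvf x)) big_ord_recl big1 ?addr0 => [|i _].
    by rewrite rpredZ ?rpred1.
  have /eqP := fx i; rewrite mulf_eq0 (negPf (NQ_neq0 i)) => /eqP phix.
  by rewrite [coord _ _ _]phix scale0r.
by rewrite linearZ /= phi1 !mulr0.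
Qed.

Lemma integral_basis_exists : exists w : 'I_n -> K,
  [/\ forall i, w i \in integers K,
  {in integers K, forall x,
     exists (m : int) (c : 'I_n -> int), x = m%:~R + \sum_i w i *~ c i} &
  forall (m : int) (c : 'I_n -> int),
    m%:~R + \sum_i w i *~ c i = 0 -> m = 0 /\ forall i, c i = 0].
Proof.
have [f f_dual f_ker] := integers_dual_system_exists.
have [w [Ow w_gen w_free]] := integral_dual_system_basis f_dual.
exists w; split=> // [x Ox|m c mc0].
  have [c /f_ker fx] := w_gen x Ox; have [|m xE] := rational_integer fx.
    by rewrite rpredB ?rpred_sum // => i _; apply: rpredMz.
  by exists m, c; rewrite -xE subrK.
have c0 : forall i, c i = 0.
  apply: w_free; apply/f_ker.
  by rewrite -(rpredDr _ (_ : m%:~R \in 1%VS)) ?rpred_int // addrC mc0 rpred0.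
split=> //; move/eqP: mc0.
rewrite big1 ?addr0 => [|i _]; last by rewrite c0 mulr0z.
by rewrite -scaler_int scaler_eq0 oner_eq0 orbF intr_eq0 => /eqP.
Qed.

End IntegralBasis.

Lemma integral_basis1_exists (K : fieldExtType rat) :
  cubic_field K -> exists a1 a2 : K, integral_basis1 a1 a2.
Proof.
move=> /integral_basis_exists[w [Ow w_gen w_free]].
have sumE (c : 'I_2 -> int) : \sum_i w i *~ c i = w 0 *~ c 0 + w 1 *~ c 1.
  rewrite !big_ord_recl big_ord0 addr0.
  by congr (_ + w _ *~ c _); apply: val_inj.
exists (w 0), (w 1).
split=> [||x /integersP Ox]; [exact/integersP | exact/integersP |].
have [m [c xE]] := w_gen x Ox; exists (m, c 0, c 1); split=> [|[[m' d0] d1]] /=.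
  by rewrite xE sumE addrA.
rewrite xE sumE => /eqP; rewrite -subr_eq0 => /eqP diff0.
pose d (i : 'I_2) := c i - (if i == 0 then d0 else d1).
have [|/eqP] := w_free (m - m') d.
  by rewrite sumE /d /= -[RHS]diff0 !mulrzBr; ring.
rewrite subr_eq0 => /eqP-> d_eq0.
by have /subr0_eq-> := d_eq0 0; have /subr0_eq-> := d_eq0 1.
Qed.

(** * Points over a subfield of the reals *)

Section SubfieldPoints.

Variables (R : rcfType) (F : divringClosed R).
Implicit Types z : R[i].

Definition sqr_modulus z : R := complex.Re z ^+ 2 + complex.Im z ^+ 2.

(* The points [z] such that [F] contains the coefficients of the real quadratic
   polynomial with roots [z] and its conjugate. *)
Definition point_over z : bool := (complex.Re z \in F) && (sqr_modulus z \in F).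

Lemma point_over_conj z : point_over z -> point_over (conjc z).
Proof. by case: z => x y; rewrite /point_over /sqr_modulus /= sqrrN. Qed.

Lemma point_over_inv z : point_over z -> point_over z^-1.
Proof.
case: z => x y /andP[Fx Fn]; apply/andP; split; rewrite /= ?rpred_div //.
suff -> : sqr_modulus (x +i* y)^-1 = (sqr_modulus (x +i* y))^-1.
  by rewrite rpredV.
rewrite /sqr_modulus /=; have [->|n_neq0] := eqVneq (x ^+ 2 + y ^+ 2) 0.
  by rewrite invr0 !mulr0 oppr0 expr0n addr0.
by field.
Qed.

Lemma point_over_affine a b z :
  a \in F -> b \in F -> point_over z -> point_over (a%:C * z + b%:C).
Proof.
case: z => x y Fa Fb /andP[Fx Fn].
have reE : complex.Re (a%:C * (x +i* y) + b%:C) = a * x + b by rewrite /=; ring.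
have modE : sqr_modulus (a%:C * (x +i* y) + b%:C) =
    a ^+ 2 * sqr_modulus (x +i* y) + 2 * a * b * x + b ^+ 2.
  by rewrite /sqr_modulus /=; ring.
apply/andP; rewrite reE modE.
by split; do ?[exact: rpred_nat | assumption | apply: rpredX | apply: rpredM
              | apply: rpredD].
Qed.

Lemma point_over_moebius a b c d z :
    a \in F -> b \in F -> c \in F -> d \in F -> point_over z ->
  point_over ((a%:C * z + b%:C) / (c%:C * z + d%:C)).
Proof.
move=> Fa Fb Fc Fd Fz.
have [->|den_neq0] := eqVneq (c%:C * z + d%:C) 0.
  by rewrite invr0 mulr0 /point_over /sqr_modulus /= expr0n addr0 !rpred0.
have [c0|c_neq0] := eqVneq c 0.
  have -> : (a%:C * z + b%:C) / (c%:C * z + d%:C) = (a / d)%:C * z + (b / d)%:C.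
    by rewrite !rmorphM !fmorphV c0 mul0r add0r mulrDl mulrAC.
  by apply: point_over_affine; rewrite ?rpred_div.
have cC_neq0 : c%:C != 0 by rewrite fmorph_eq0.
have -> : (a%:C * z + b%:C) / (c%:C * z + d%:C) =
    (b - a * d / c)%:C * (c%:C * z + d%:C)^-1 + (a / c)%:C.
  by rewrite rmorphB !rmorphM !fmorphV /=; field; rewrite den_neq0 cC_neq0.
apply/point_over_affine/point_over_inv/point_over_affine => //.
  by rewrite rpredB // rpred_div // rpredM.
by rewrite rpred_div.
Qed.

End SubfieldPoints.

Lemma point_over_GL2Z_act (R : realType) (F : divringClosed R) (g : 'M[int]_2)
  (z : R[i]) : point_over F z -> point_over F (GL2Z_act g z).
Proof.
move=> Fz; rewrite /GL2Z_act -!(rmorph_int (real_complex R)).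
apply: point_over_moebius; rewrite ?rpred_int //.
by case: ifP => // _; apply: point_over_conj.
Qed.

Lemma GL2Z_act1 (R : realType) (z : R[i]) : GL2Z_act 1%:M z = z.
Proof.
by rewrite /GL2Z_act det1 eqxx !mxE /= mul1r mul0r addr0 add0r divr1.
Qed.

Section FormPoint.

Variables (R : realType) (Q : int -> int -> R) (a b c : R).
Hypotheses (Q10 : Q 1 0 = a) (Q01 : Q 0 1 = c) (Q11 : Q 1 1 = a + 2 * b + c).

Lemma Re_form_point : complex.Re (form_point Q) = b / a.
Proof.
rewrite /form_point /= Q10 Q01 Q11.
have [->|a_neq0] := eqVneq a 0; first by rewrite mulr0 invr0 !mulr0.
by field.
Qed.

Lemma sqr_modulus_form_point :
  b ^+ 2 <= a * c -> sqr_modulus (form_point Q) = c / a.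
Proof.
move=> disc_ge0; rewrite /sqr_modulus Re_form_point /form_point /= Q10 Q01 Q11.
rewrite !exprMn sqr_sqrtr; last by lra.
have [->|a_neq0] := eqVneq a 0; first by rewrite !(mulr0, invr0, expr0n) addr0.
by field.
Qed.

End FormPoint.

Lemma psd_form_discriminant (R : realFieldType) (a b c : R) :
  (forall x y, 0 <= a * x ^+ 2 + 2 * b * x * y + c * y ^+ 2) -> b ^+ 2 <= a * c.
Proof.
move=> psd; have a_ge0 : 0 <= a by have := psd 1 0; lra.
have [a_gt0|a_le0] := ltP 0 a.
  by rewrite -subr_ge0 -(pmulr_rge0 _ a_gt0); have := psd b (- a); lra.
have a0 : a = 0 by lra.
by have := psd (c + 1) (- (2 * b)); rewrite a0; lra.
Qed.

(** * The inner product on Minkowski space *)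

Lemma Re_mulJ (R : rcfType) (z w : R[i]) :
  complex.Re (z * conjc w) =
  complex.Re z * complex.Re w + complex.Im z * complex.Im w.
Proof. by case: z w => a b [c d] /=; ring. Qed.

Definition minkowski_pairing (R : rcfType) (K : fieldExtType rat) (n : nat)
    (sigma : 'I_n -> {rmorphism K -> R[i]}) (x y : K) : R :=
  \sum_i complex.Re (sigma i x * conjc (sigma i y)).

Section MinkowskiPairing.

Variables (R : rcfType) (K : fieldExtType rat) (n : nat).
Variable sigma : 'I_n -> {rmorphism K -> R[i]}.
Local Notation M := (minkowski_pairing sigma).

Lemma minkowski_pairing_cauchy_schwarz x y : M x y ^+ 2 <= M x x * M y y.
Proof.
apply: psd_form_discriminant => a b.
rewrite /minkowski_pairing mulr_sumr !mulr_suml.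
rewrite -!big_split sumr_ge0 // => i _; rewrite /= !Re_mulJ.
have := sqr_ge0 (a * complex.Re (sigma i x) + b * complex.Re (sigma i y)).
have := sqr_ge0 (a * complex.Im (sigma i x) + b * complex.Im (sigma i y)).
by lra.
Qed.

End MinkowskiPairing.

Section ShapePoint.

Variables (R : realType) (K : fieldExtType rat).
Variables (sigma : 'I_3 -> {rmorphism K -> R[i]}) (a1 a2 : K).
Local Notation M := (minkowski_pairing sigma).

Lemma shape_formE (m n : int) : shape_form sigma a1 a2 m n =
  M (perp a1) (perp a1) * m%:~R ^+ 2 + 2 * M (perp a1) (perp a2) * m%:~R * n%:~R
  + M (perp a2) (perp a2) * n%:~R ^+ 2.
Proof.
rewrite /shape_form /minkowski_pairing mulr_sumr !mulr_suml -!big_split.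
apply: eq_bigr => i _ /=; rewrite rmorphD !rmorphMz !Re_mulJ.
rewrite -(mulrzr (sigma i (perp a1))) -(mulrzr (sigma i (perp a2))).
rewrite -!(rmorph_int (real_complex R)).
case: (sigma i (perp a1)) (sigma i (perp a2)) => [a b] [c d] /=.
rewrite /Normc.normc sqr_sqrtr ?addr_ge0 ?sqr_ge0 //.
by ring.
Qed.

Definition shape_point : R[i] := form_point (shape_form sigma a1 a2).

Lemma Re_shape_point :
  complex.Re shape_point = M (perp a1) (perp a2) / M (perp a1) (perp a1).
Proof.
apply: (@Re_form_point _ _ _ _ (M (perp a2) (perp a2)));
  rewrite shape_formE; ring.
Qed.

Lemma sqr_modulus_shape_point :
  sqr_modulus shape_point = M (perp a2) (perp a2) / M (perp a1) (perp a1).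
Proof.
apply: (sqr_modulus_form_point (b := M (perp a1) (perp a2)));
  [rewrite shape_formE; ring.. | exact: minkowski_pairing_cauchy_schwarz].
Qed.

End ShapePoint.

Lemma real_embedding (R : rcfType) (K : fieldExtType rat)
    (s : {rmorphism K -> R[i]}) :
    (forall x, conjc (s x) = s x) ->
  exists rho : {rmorphism K -> R}, forall x, (rho x)%:C = s x.
Proof.
move=> s_real; apply: (@rmorphism_factor K R R[i] s (real_complex R)).
  exact: complexI.
move=> x; exists (complex.Re (s x)); rewrite /= ReJ_add s_real.
by field.
Qed.

Definition totally_real (R : rcfType) (K : fieldExtType rat) (n : nat)
    (sigma : 'I_n -> {rmorphism K -> R[i]}) : Prop :=
  forall i x, conjc (sigma i x) = sigma i x.

Section TraceOfEmbeddings.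

Variables (R : rcfType) (K : fieldExtType rat) (n : nat).
Variable sigma : 'I_n -> {rmorphism K -> R[i]}.
Hypotheses (dimK : \dim {:K} = n) (sigma_enum : embedding_enumeration sigma).

Lemma field_trace_Re x : ratr (field_trace x) = \sum_i complex.Re (sigma i x).
Proof.
have /(congr1 (@complex.Re R)) := field_trace_sum dimK sigma_enum x.
rewrite -(fmorph_rat (real_complex R)) /= => ->.
by apply: (big_morph (@complex.Re R)) => // -[a b] [c d].
Qed.

Lemma minkowski_pairing_totally_real x y :
  totally_real sigma ->
  minkowski_pairing sigma x y = ratr (field_trace (x * y)).
Proof.
move=> sigma_real; rewrite field_trace_Re; apply: eq_bigr => i _.
by rewrite sigma_real rmorphM.
Qed.

End TraceOfEmbeddings.

Lemma exists_notin (T : finType) (s : seq T) :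
  (size s < #|T|)%N -> exists x, x \notin s.
Proof.
move=> lt_s; apply/existsP; apply: contraLR lt_s => /existsPn all_s.
rewrite -leqNgt; apply: leq_trans (card_size s).
by apply/subset_leq_card/fintype.subsetP => x _; apply/negPn/all_s.
Qed.

Lemma big_uniq_full (A : Type) (idx : A) (op : Monoid.com_law idx) (T : finType)
    (s : seq T) (F : T -> A) :
  uniq s -> size s = #|T| -> \big[op/idx]_x F x = \big[op/idx]_(x <- s) F x.
Proof.
move=> s_uniq s_size; rewrite [RHS]big_uniq //; apply: eq_bigl.
apply/fsym/subset_cardP; last exact: subset_predT.
by rewrite (card_uniqP s_uniq).
Qed.

Section CubicSignature.

Variables (R : realType) (K : fieldExtType rat).
Variable sigma : 'I_3 -> {rmorphism K -> R[i]}.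
Hypotheses (cubicK : cubic_field K) (sigma_enum : complex_embeddings sigma).
Local Notation M := (minkowski_pairing sigma).

(* Complex conjugation acts on the three embeddings as an involution. *)
Lemma totally_real_or_conjugate_pair : totally_real sigma \/
  exists i j k, [/\ uniq [:: k; i; j], forall x, conjc (sigma i x) = sigma j x &
    forall x, conjc (sigma k x) = sigma k x].
Proof.
have /fin_all_exists[p pE] i :
    exists j, forall x, conjc (sigma i x) = sigma j x.
  have [j [jE _]] := sigma_enum (conjc \o sigma i : {rmorphism K -> R[i]}).
  by exists j.
have pK : involutive p.
  move=> i; apply: (embedding_enumeration_inj sigma_enum) => x.
  by rewrite -!pE conjcK.
have [p_id|/existsNP[i /eqP pi_neq]] := pselect (forall i, p i = i).
  by left=> i x; rewrite pE p_id.
have [k k_notin] : exists k, k \notin [:: i; p i].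
  by apply: exists_notin; rewrite card_ord.
have ik_uniq : uniq [:: k; i; p i].
  by rewrite cons_uniq k_notin /= inE eq_sym pi_neq.
right; exists i, (p i), k; split=> // x; rewrite pE.
suff -> : p k = k by [].
apply/eqP/negP => /negP pk_neq.
have /card_uniqP pk_card : uniq [:: p k; k; i; p i].
  rewrite cons_uniq ik_uniq andbT inE negb_or pk_neq; move: k_notin.
  by rewrite !inE (can2_eq pK pK) (inj_eq (can_inj pK)) orbC.
by have := max_card (mem [:: p k; k; i; p i]); rewrite pk_card card_ord.
Qed.

Lemma minkowski_pairing_complex (rho : {rmorphism K -> R}) (i j k : 'I_3) x y :
    uniq [:: k; i; j] -> (forall x, conjc (sigma i x) = sigma j x) ->
    (forall x, (rho x)%:C = sigma k x) ->
    field_trace x = 0 -> field_trace y = 0 ->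
  M x y = rho (perp (x * y)).
Proof.
move=> kij_uniq ij rhoE tx ty.
have sum3 (f : 'I_3 -> R) : \sum_l f l = f k + (f i + f j).
  rewrite (big_uniq_full _ _ kij_uniq) ?card_ord //.
  by rewrite !big_cons big_nil /= addr0.
have trE z : ratr (field_trace z) = rho z + 2 * complex.Re (sigma i z).
  rewrite (field_trace_Re cubicK sigma_enum) sum3 -ij -rhoE.
  by case: (sigma i z) => a b /=; ring.
have := trE x; rewrite tx rmorph0; have := trE y; rewrite ty rmorph0.
rewrite /minkowski_pairing sum3 -!ij -!rhoE conjcK.
rewrite rmorphB rmorphMn rmorphZ_num rmorph1 mulr1 trE !rmorphM.
case: (sigma i x) (sigma i y) => [a b] [c d] /= rho_y rho_x.
have -> : rho x = - (2 * a) by lra.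
have -> : rho y = - (2 * c) by lra.
by ring.
Qed.

End CubicSignature.

(** * Shapes of cubic fields *)

Section Perp.

Variable K : fieldExtType rat.
Implicit Types x y u v : K.

Lemma perp_is_linear : linear (@perp K).
Proof.
move=> c x y; rewrite /perp linearP scalerDl -scalerA scalerBr.
by rewrite mulrnDl -scalerMnr; ring.
Qed.

HB.instance Definition _ :=
  GRing.isLinear.Build rat K K *:%R (@perp K) perp_is_linear.

Lemma perp_eq0_rational x : perp x = 0 -> x \in 1%VS.
Proof.
move/subr0_eq => perp0; have : x *+ 3 \in 1%VS by rewrite perp0 rpredZ ?rpred1.
by rewrite -scaler_nat rpredZeq pnatr_eq0.
Qed.

Hypothesis cubicK : cubic_field K.

Lemma field_trace_perp x : field_trace (perp x) = 0.
Proof.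
rewrite /perp linearB linearMn linearZ /= field_trace1 cubicK.
by rewrite mulr_natr subrr.
Qed.

Lemma cubic_primitive_element x : x \notin 1%VS -> primitive_element x.
Proof.
move=> x_irr; apply/eqP; rewrite eqEdim subvf dim_Fadjoin dimv1 muln1 cubicK.
have := field_dimS (subvf <<1; x>>%AS); rewrite cubicK dim_Fadjoin dimv1 muln1.
by rewrite dvdn_divisors // !inE adjoin_deg_eq1 (negPf x_irr) => /eqP->.
Qed.

Lemma cubic_quadratic_free u v (a b c : rat) : u != 0 -> v / u \notin 1%VS ->
  a *: u ^+ 2 + b *: (u * v) + c *: v ^+ 2 = 0 -> [/\ a = 0, b = 0 & c = 0].
Proof.
move=> u_neq0 /cubic_primitive_element vu_prim abc0.
have p0 : Poly [:: a; b; c] = 0.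
  apply: (primitive_element_free vu_prim); first by rewrite cubicK size_Poly.
  apply: (mulIf (expf_neq0 2 u_neq0)); rewrite mul0r -[RHS]abc0.
  rewrite /= !cons_poly_def mul0r add0r !(rmorphD, rmorphM) /=.
  rewrite !horner_algX !horner_algC.
  by rewrite -!(mulr_algl _ (_ ^+ 2)) -(mulr_algl _ (u * v)); field.
have coefs0 i : [:: a; b; c]`_i = 0 by rewrite -coef_Poly p0 coef0.
by split; [exact: (coefs0 0) | exact: (coefs0 1) | exact: (coefs0 2)].
Qed.

Lemma perp_sqr_neq0 u : u != 0 -> field_trace u = 0 -> perp (u ^+ 2) != 0.
Proof.
move=> u_neq0 tu; apply/eqP => /perp_eq0_rational/vlineP[q uuE].
have u_irr : u \notin 1%VS.
  apply: contra u_neq0 => /vlineP[c uE]; move: tu.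
  rewrite uE linearZ /= field_trace1 cubicK => /eqP.
  by rewrite mulf_eq0 orbF => /eqP->; rewrite scale0r.
have [] : [/\ - q = 0, 0 = 0 :> rat & 1 = 0 :> rat].
  apply: (@cubic_quadratic_free 1 u); rewrite ?oner_eq0 ?divr1 //.
  by rewrite expr1n scale0r addr0 scaleNr scale1r uuE addNr.
by move=> _ _ /eqP; rewrite oner_eq0.
Qed.

(* Otherwise [u * v] and [v ^ 2] are, up to rationals, rational multiples of
   [u ^ 2], which is incompatible with the freeness of the three products. *)
Lemma perp_quadratic_irrational u v :
    u != 0 -> v / u \notin 1%VS -> perp (u ^+ 2) != 0 ->
  perp (u * v) / perp (u ^+ 2) \notin 1%VS \/
  perp (v ^+ 2) / perp (u ^+ 2) \notin 1%VS.
Proof.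
move=> u_neq0 vu_irr q_neq0; apply/orP; rewrite -negb_and; apply/negP.
have proportional x : perp x / perp (u ^+ 2) \in 1%VS ->
    exists c d : rat, x = c *: u ^+ 2 + d%:A.
  move=> /vlineP[c /(canRL (divfK q_neq0))]; rewrite mulr_algl => perpE.
  have /vlineP[d dE] : x - c *: u ^+ 2 \in 1%VS.
    by apply: perp_eq0_rational; rewrite linearB linearZ /= perpE subrr.
  by exists c, d; rewrite -dE addrC subrK.
move=> /andP[/proportional[m [d uvE]] /proportional[l [e vvE]]].
have free := cubic_quadratic_free u_neq0 vu_irr.
have [_ e0 /oppr_inj d0] : [/\ d * l - e * m = 0, e = 0 & - d = - 0].
  rewrite oppr0; apply: free; rewrite uvE vvE scalerBl !scalerDr !scalerA.
  by rewrite !mulNr !scaleNr (mulrC d e); ring.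
have [_ /eqP] : [/\ - m = 0, 1 = 0 :> rat & 0 = 0 :> rat].
  apply: free; rewrite uvE d0 !scale0r !addr0.
  by rewrite scale1r scaleNr addNr.
by rewrite oner_eq0.
Qed.

End Perp.

Section CubicShape.

Variables (R : realType) (K : fieldExtType rat).
Variable sigma : 'I_3 -> {rmorphism K -> R[i]}.
Hypotheses (cubicK : cubic_field K) (sigma_enum : complex_embeddings sigma).

Lemma cubic_shape_point_over (a1 a2 : K) : exists rho : {rmorphism K -> R},
  point_over (rmorph_image rho) (shape_point sigma a1 a2).
Proof.
suff [rho rhoP] : exists rho : {rmorphism K -> R}, forall x y,
    field_trace x = 0 -> field_trace y = 0 ->
    minkowski_pairing sigma x y \in rmorph_image rho.
  exists rho; apply/andP; rewrite Re_shape_point sqr_modulus_shape_point.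
  by split; rewrite rpred_div ?rhoP ?field_trace_perp.
have [sigma_real|[i [j [k [kij_uniq ij /real_embedding[rho rhoE]]]]]] :=
  totally_real_or_conjugate_pair sigma_enum.
  have [rho _] := real_embedding (sigma_real ord0); exists rho => x y _ _.
  rewrite (minkowski_pairing_totally_real cubicK sigma_enum _ _ sigma_real).
  by rewrite -(fmorph_rat rho) mem_rmorph_image.
exists rho => x y tx ty.
rewrite (minkowski_pairing_complex cubicK sigma_enum kij_uniq ij rhoE tx ty).
exact: mem_rmorph_image.
Qed.

Lemma complex_cubic_not_totally_real :
  complex_cubic_field R K -> ~ totally_real sigma.
Proof.
move=> [_ [rho rho_unique]] sigma_real.
have sigmaE i x : sigma i x = (rho x)%:C.
  by have [f fE] := real_embedding (sigma_real i); rewrite -fE rho_unique.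
suff : ord0 = ord_max :> 'I_3 by [].
by apply: (embedding_enumeration_inj sigma_enum) => x; rewrite !sigmaE.
Qed.

Lemma complex_cubic_shape_point : complex_cubic_field R K ->
  exists rho : {rmorphism K -> R}, forall a1 a2 (u := perp a1) (v := perp a2),
    complex.Re (shape_point sigma a1 a2) = rho (perp (u * v) / perp (u ^+ 2)) /\
    sqr_modulus (shape_point sigma a1 a2) = rho (perp (v ^+ 2) / perp (u ^+ 2)).
Proof.
move=> complexK.
have [/complex_cubic_not_totally_real//|] :=
  totally_real_or_conjugate_pair sigma_enum.
move=> [i [j [k [kij_uniq ij /real_embedding[rho rhoE]]]]].
have pairingE := minkowski_pairing_complex cubicK sigma_enum kij_uniq ij rhoE.
exists rho => a1 a2 u v.
rewrite Re_shape_point sqr_modulus_shape_point !fmorph_div.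
by rewrite !pairingE ?field_trace_perp.
Qed.

End CubicShape.

Section IntegralBasisPerp.

Variables (K : fieldExtType rat) (a1 a2 : K).
Hypotheses (cubicK : cubic_field K) (a_basis : integral_basis1 a1 a2).

Lemma integral_basis1_free : free [:: a2; a1; 1].
Proof.
apply: (@basis_free _ _ fullv); rewrite basisEdim cubicK andbT.
apply/subvP => x _; have [N N_neq0 /integersP] := integer_multiple x.
have [_ _ a_gen] := a_basis; move=> /a_gen[[[m c1] c2] [/= xE _]].
suff : (N%:~R : rat) *: x \in <<[:: a2; a1; 1%R]>>%VS.
  by rewrite rpredZeq intr_eq0 (negPf N_neq0).
by rewrite scaler_int xE !rpredD // rpredMz // memv_span // !inE eqxx ?orbT.
Qed.

Lemma integral_basis1_perp_neq0 : perp a1 != 0.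
Proof.
have := integral_basis1_free; rewrite !free_cons => /and3P[_ + _].
by apply: contra => /eqP/perp_eq0_rational; rewrite span_seq1.
Qed.

Lemma integral_basis1_perp_ratio : perp a2 / perp a1 \notin 1%VS.
Proof.
have := integral_basis1_free; rewrite free_cons => /andP[+ _].
apply: contra => /vlineP[c /(canRL (divfK integral_basis1_perp_neq0))].
rewrite mulr_algl => perpE; have a_rat : a2 - c *: a1 \in 1%VS.
  by apply: perp_eq0_rational; rewrite linearB linearZ /= perpE subrr.
rewrite -(subrK (c *: a1) a2) span_cons addrC memv_add ?span_seq1 //.
by rewrite memvZ ?memv_line.
Qed.

End IntegralBasisPerp.

Lemma mem_cubic_shape (R : realType) (K : fieldExtType rat)
    (sigma : 'I_3 -> {rmorphism K -> R[i]}) (a1 a2 : K) :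
    complex_embeddings sigma -> integral_basis1 a1 a2 ->
  cubic_shape R K (shape_point sigma a1 a2).
Proof.
by exists sigma, a1, a2; split=> //; exists 1%:M; rewrite ?unitmx1 ?GL2Z_act1.
Qed.

Lemma cubic_shape_over (R : realType) (L : fieldExtType rat) (z : R[i]) :
    cubic_field L -> cubic_shape R L z ->
  exists rho : {rmorphism L -> R}, point_over (rmorph_image rho) z.
Proof.
move=> cubicL [sigma [a1 [a2 [sigma_enum _ [g _ ->]]]]].
have [rho rhoP] := cubic_shape_point_over cubicL sigma_enum a1 a2.
by exists rho; apply: point_over_GL2Z_act.
Qed.

Lemma complex_cubic_shape_irrational (R : realType) (K : fieldExtType rat) :
    complex_cubic_field R K ->
  exists2 z, cubic_shape R K z & exists rho : {rmorphism K -> R},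
    forall F : divringClosed R,
      point_over F z -> exists2 x, x \notin 1%VS & rho x \in F.
Proof.
move=> complexK; have [cubicK _] := complexK.
have [sigma sigma_enum] := embedding_enumeration_exists R[i] cubicK.
have [a1 [a2 a_basis]] := integral_basis1_exists cubicK.
have [rho /(_ a1 a2)[ReE modE]] :=
  complex_cubic_shape_point cubicK sigma_enum complexK.
exists (shape_point sigma a1 a2); first exact: mem_cubic_shape.
exists rho => F /andP[]; rewrite ReE modE => FRe Fmod.
have u_neq0 := integral_basis1_perp_neq0 cubicK a_basis.
have uu_neq0 := perp_sqr_neq0 cubicK u_neq0 (field_trace_perp cubicK a1).
have vu_irr := integral_basis1_perp_ratio cubicK a_basis.
have [x_irr|x_irr] := perp_quadratic_irrational cubicK u_neq0 vu_irr uu_neq0.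
  by eexists; [exact: x_irr | ].
by eexists; [exact: x_irr | ].
Qed.

Lemma cubic_shape_eq_isomorphic (R : realType) (K L : fieldExtType rat) :
    complex_cubic_field R K -> cubic_field L ->
    cubic_shape R K = cubic_shape R L ->
  isomorphic_fields K L.
Proof.
move=> complexK cubicL shapeKL; have [cubicK _] := complexK.
have [z + [rhoK z_irr]] := complex_cubic_shape_irrational complexK.
rewrite shapeKL => /(cubic_shape_over cubicL)[rhoL /z_irr[x x_irr Lx]].
apply: isomorphic_of_primitive_in_image Lx; first by rewrite cubicK.
exact: cubic_primitive_element.
Qed.

Theorem theoremA (R : realType) :
  (forall K L : fieldExtType rat,
      complex_cubic_field R K -> cubic_field L -> ~ isomorphic_fields K L ->
      cubic_shape R K <> cubic_shape R L)
  /\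
  (forall K L : fieldExtType rat,
      complex_cubic_field R K -> complex_cubic_field R L ->
      cubic_shape R K = cubic_shape R L -> isomorphic_fields K L).
Proof.
split=> [K L complexK cubicL notKL|K L complexK [cubicL _]].
  by move=> /(cubic_shape_eq_isomorphic complexK cubicL).
exact: cubic_shape_eq_isomorphic.
Qed.
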